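(* For any (Hausdorff) topological group $G$, the pair $(\beta G_d/\Psi,\mathfrak h_\Psi)$ is the Bohr compactification of $G$, where $\Psi$ is the least closed congruence on $\beta G_d$ such that $$\{(u,1_G):u \text{ is a Schur ultrafilter on } G\}\cup\{(u,1_G):u\in \mathrm{Ult}(G)\}\subset\Psi,$$ and $\mathfrak h_\Psi:G\to\beta G_d/\Psi$ is given by $\mathfrak h_\Psi(x)=[x]_\Psi$.
   Context: All topological spaces are assumed Hausdorff. A topological group is a group with a topology in which multiplication and inversion are continuous. $G_d$ denotes the group $G$ endowed with the discrete topology. For a discrete semigroup $S$, $\beta S$ is the Stone-Čech compactification of $S$: the set of all ultrafilters on $S$ with the topology given by the base of sets $\{u\in\beta S:A\in u\}$, $A\subseteq S$; each $x\in S$ is identified with the principal ultrafilter $\{A\subseteq S:x\in A\}$. The operation of $S$ extends to $\beta S$ by: $A\in uv$ iff $\{s\in S:\{t\in S: st\in A\}\in v\}\in u$; with it $\beta S$ is a compact semigroup with all right shifts $x\mapsto xu$ continuous. A congruence on a semigroup $S$ is an equivalence relation $\rho$ such that $(a_1,b_1),(a_2,b_2)\in\rho$ imply $(a_1a_2,b_1b_2)\in\rho$; $[x]_\rho$ is the $\rho$-class of $x$ and $S/\rho$ is the quotient semigroup, with operation $[x]_\rho[y]_\rho=[xy]_\rho$ and the quotient topology. A congruence on $\beta G_d$ is closed if it is a closed subset of $\beta G_d\times\beta G_d$; intersections of closed congruences are closed congruences, so the least closed congruence containing a given relation exists. An ultrafilter $u$ on a group $G$ is Schur if for each $U\in u$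 there exist $x,y\in U$ such that $xy\in U$. $\mathrm{Ult}(G)$ is the set of all ultrafilters on $G$ convergent to the unit $1_G$ in the topology of $G$. The Bohr compactification of a topological group $G$ is a pair $(\mathfrak bG,b)$ consisting of a compact topological group $\mathfrak bG$ and a continuous homomorphism $b:G\to\mathfrak bG$ such that $b(G)$ is dense in $\mathfrak bG$ and for each compact topological group $H$ and continuous homomorphism $f:G\to H$ there exists a continuous homomorphism $g:\mathfrak bG\to H$ with $f=g\circ b$. (This determines $\mathfrak bG$ up to topological isomorphism.) *)

(* Defs.v *)
From HB Require Import structures.
From mathcomp Require Import all_boot.
From mathcomp Require Import all_classical topology.

Set Implicit Arguments.
Unset Strict Implicit.
Unset Printing Implicit Defensive.

Local Open Scope classical_set_scope.
Local Open Scope group_scope.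

(* No compatibility between the operation and the topology is required here:
   the multiplication of [beta S] below is in general not continuous. *)
#[short(type="pretopologicalSemigroupType")]
HB.structure Definition PreTopologicalSemigroup :=
  {S of Semigroup S & Topological S}.

#[short(type="pretopologicalGroupType")]
HB.structure Definition PreTopologicalGroup := {G of Group G & Topological G}.

HB.mixin Record PreTopologicalGroup_isTopologicalGroup G
    of PreTopologicalGroup G := {
  mulg_continuous : continuous (fun p : G * G => p.1 * p.2) ;
  invg_continuous : continuous (fun x : G => x^-1)
}.

#[short(type="topologicalGroupType")]
HB.structure Definition TopologicalGroup :=
  {G of PreTopologicalGroup_isTopologicalGroup G & PreTopologicalGroup G}.

Section is_topological_group.
Variable S : pretopologicalSemigroupType.
Local Notation op := (fun x y : S => x * y).

Definition is_topological_group : Prop :=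
  continuous (fun p : S * S => p.1 * p.2) /\
  exists (e : S) (inv : S -> S),
    [/\ left_id e op, right_id e op,
        left_inverse e inv op, right_inverse e inv op & continuous inv].

End is_topological_group.

(* [bG] only carries an operation and a topology, so that being a topological
   group is part of the assertion. *)
Definition is_bohr_compactification (G : topologicalGroupType)
    (bG : pretopologicalSemigroupType) (b : G -> bG) : Prop :=
  [/\ [/\ is_topological_group bG, hausdorff_space bG & compact [set: bG]],
      continuous b,
      {morph b : x y / x * y},
      dense (range b) &
      forall (H : topologicalGroupType) (f : G -> H),
        hausdorff_space H -> compact [set: H] ->
        continuous f -> {morph f : x y / x * y} ->
        exists g : bG -> H,
          [/\ continuous g, {morph g : x y / x * y} & f = g \o b]].

(* The points are ultrafilters on the bare set [S], so the discrete topology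
   on [S] is implicit; a topology that [S] may carry plays no role. *)
Record beta (S : Type) := Beta {
  ultra_sets :> set_system S ;
  ultra_setsP : UltraFilter ultra_sets }.

#[global] Existing Instance ultra_setsP.

HB.instance Definition _ (S : Type) := gen_eqMixin (beta S).
HB.instance Definition _ (S : Type) := gen_choiceMixin (beta S).

Lemma beta_ext (S : Type) (u v : beta S) :
  (forall A, ultra_sets u A <-> ultra_sets v A) -> u = v.
Proof.
case: u v => [u uU] [v vU] /= uv.
have {uv} : u = v by apply/funext => A; apply/propext.
by move=> uv; subst v; congr Beta; exact: Prop_irrelevance.
Qed.

Section beta_topology.
Variable S : Type.

Definition beta_base (A : set S) : set (beta S) := [set u | ultra_sets u A].

Lemma beta_base_cover : \bigcup_(A in setT) beta_base A = setT.
Proof.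
by rewrite -subTset => u _; exists setT => //=; rewrite /beta_base /=;
  exact: filterT.
Qed.

Lemma beta_base_join (A B : set S) (u : beta S) :
  setT A -> setT B -> beta_base A u -> beta_base B u ->
  exists C, [/\ setT C, beta_base C u &
                beta_base C `<=` beta_base A `&` beta_base B].
Proof.
move=> _ _ uA uB; exists (A `&` B); split => //; first exact: filterI.
by move=> v vAB; split; apply: filterS vAB; [exact: subIsetl|exact: subIsetr].
Qed.

HB.instance Definition _ :=
  isBaseTopological.Build (beta S) beta_base_cover beta_base_join.

Definition principal (x : S) : beta S := Beta (principal_filter_ultra x).

End beta_topology.

Section beta_semigroup.
Variable S : semigroupType.
Implicit Types u v w : beta S.

Definition beta_mul_sets u v : set_system S :=
  [set A | ultra_sets u [set s | ultra_sets v [set t | A (s * t)]]].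

Lemma beta_mul_ultra u v : UltraFilter (beta_mul_sets u v).
Proof.
have mulF : Filter (beta_mul_sets u v).
  split.
  - by apply: filterS (@filterT _ (ultra_sets u) _) => s _ /=; exact: filterT.
  - move=> A B; rewrite /beta_mul_sets /= => uA uB.
    by apply: filterS (filterI uA uB) => s [/= vA vB]; exact: (filterI vA vB).
  - move=> A B AB; rewrite /beta_mul_sets /=.
    by apply: filterS => s /=; apply: filterS => t; exact: AB.
have mulPF : ProperFilter (beta_mul_sets u v).
  apply: Build_ProperFilter_ex => // A; rewrite /beta_mul_sets /= => uA.
  by have [s /= /filter_ex [t At]] := filter_ex uA; exists (s * t).
split => [//|F FF mulF_F]; rewrite eqEsubset; split => // A FA.
have [//|uA] := in_ultra_setVsetC
  [set s | ultra_sets v [set t | A (s * t)]] (ultra_setsP u).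
suff /mulF_F FnA : beta_mul_sets u v (~` A).
  by have /filter_ex [x []] : F (A `&` ~` A) by exact: filterI.
apply: filterS uA => s /= nvA.
by have [|//] := in_ultra_setVsetC [set t | A (s * t)] (ultra_setsP v).
Qed.

Definition beta_mul u v : beta S := Beta (beta_mul_ultra u v).

Lemma beta_mulA : associative beta_mul.
Proof.
move=> u v w; apply: beta_ext => A.
rewrite /= /beta_mul_sets /=.
suff -> :
    [set s | ultra_sets v [set t | ultra_sets w [set r | A (s * (t * r))]]] =
    [set s | ultra_sets v [set t | ultra_sets w [set r | A (s * t * r)]]] by [].
apply/funext => s /=; congr (ultra_sets v); apply/funext => t /=.
by congr (ultra_sets w); apply/funext => r /=; rewrite mulgA.
Qed.

HB.instance Definition _ := isSemigroup.Build (beta S) beta_mulA.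

End beta_semigroup.

Record is_congruence (S : semigroupType) (rho : set (S * S)) : Prop :=
  IsCongruence {
  congruence_refl : forall x, rho (x, x) ;
  congruence_sym : forall x y, rho (x, y) -> rho (y, x) ;
  congruence_trans : forall x y z, rho (x, y) -> rho (y, z) -> rho (x, z) ;
  congruence_mul : forall a1 b1 a2 b2,
    rho (a1, b1) -> rho (a2, b2) -> rho (a1 * a2, b1 * b2) }.

Section quotient.
Local Open Scope quotient_scope.
Variables (S : pretopologicalSemigroupType) (rho : set (S * S)).
Hypothesis rho_congr : is_congruence rho.

Let rhob (x y : S) : bool := `[< rho (x, y) >].

Let rhob_refl : reflexive rhob.
Proof. by move=> x; apply/asboolP; exact: congruence_refl. Qed.

Let rhob_sym : symmetric rhob.
Proof.
by move=> x y; apply/asboolP/asboolP; exact: congruence_sym.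
Qed.

Let rhob_trans : transitive rhob.
Proof.
move=> y x z /asboolP xy /asboolP yz; apply/asboolP.
exact: congruence_trans xy yz.
Qed.

Definition congruence_equiv : equiv_rel S :=
  EquivRel rhob rhob_refl rhob_sym rhob_trans.

Definition congruence_quotient : Type :=
  quotient_topology {eq_quot congruence_equiv}.

HB.instance Definition _ := Topological.on congruence_quotient.
HB.instance Definition _ := Quotient.on congruence_quotient.

Local Notation Q := congruence_quotient.

Definition congruence_class (x : S) : Q := \pi_Q x.

Lemma congruence_classP x y :
  congruence_class x = congruence_class y <-> rho (x, y).
Proof.
rewrite /congruence_class; split => [/eqmodP /asboolP //|xy].
by apply/eqmodP/asboolP.
Qed.

Definition quotient_mul (a b : Q) : Q := congruence_class (repr a * repr b).

Lemma quotient_mulE x y :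
  quotient_mul (congruence_class x) (congruence_class y) =
  congruence_class (x * y).
Proof.
by apply/congruence_classP; apply: congruence_mul => //;
  apply/congruence_classP; exact: reprK.
Qed.

Lemma quotient_mulA : associative quotient_mul.
Proof.
move=> a b c; rewrite -[a]reprK -[b]reprK -[c]reprK.
by rewrite -!/(congruence_class _) !quotient_mulE mulgA.
Qed.

HB.instance Definition _ := isSemigroup.Build Q quotient_mulA.

End quotient.

Definition is_closed_congruence (S : pretopologicalSemigroupType)
  (rho : set (S * S)) : Prop := is_congruence rho /\ closed rho.

Section least_closed_congruence.
Variables (S : pretopologicalSemigroupType) (E : set (S * S)).

Definition least_closed_congruence : set (S * S) :=
  \bigcap_(rho in [set rho | is_closed_congruence rho /\ E `<=` rho]) rho.

Lemma least_closed_congruence_closed :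
  is_closed_congruence least_closed_congruence.
Proof.
split; last by apply: closed_bigI => rho [[]].
split.
- by move=> x rho [[[]]].
- by move=> x y xy rho Hrho; apply: (congruence_sym Hrho.1.1); exact: xy.
- move=> x y z xy yz rho Hrho.
  by apply: (congruence_trans Hrho.1.1 (xy _ Hrho)); exact: yz.
- move=> a1 b1 a2 b2 ab1 ab2 rho Hrho.
  by apply: (congruence_mul Hrho.1.1); [exact: ab1|exact: ab2].
Qed.

Lemma sub_least_closed_congruence : E `<=` least_closed_congruence.
Proof. by move=> p Ep rho [_]; apply. Qed.

Lemma least_closed_congruence_min (rho : set (S * S)) :
  is_closed_congruence rho -> E `<=` rho -> least_closed_congruence `<=` rho.
Proof. by move=> rhoC Erho p; apply. Qed.

End least_closed_congruence.

Definition is_schur (G : groupType) (u : beta G) : Prop :=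
  forall U, ultra_sets u U -> exists x y, [/\ U x, U y & U (x * y)].

Section Psi.
Variable G : topologicalGroupType.

Definition Ult : set (beta G) := [set u | ultra_sets u --> (1 : G)].

Definition Psi_gen : set (beta G * beta G) :=
  [set (u, principal (1 : G)) | u in [set u | is_schur u]] `|`
  [set (u, principal (1 : G)) | u in Ult].

Definition Psi : set (beta G * beta G) := least_closed_congruence Psi_gen.

Lemma Psi_congruence : is_congruence Psi.
Proof. exact: (least_closed_congruence_closed _).1. Qed.

Definition beta_mod_Psi : pretopologicalSemigroupType :=
  congruence_quotient Psi_congruence.

Definition hPsi (x : G) : beta_mod_Psi :=
  congruence_class Psi_congruence (principal x).

End Psi.

(* Main.v *)
Require Import Defs.
From mathcomp Require Import all_boot.
From mathcomp Require Import all_classical topology.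

Set Implicit Arguments.
Unset Strict Implicit.
Unset Printing Implicit Defensive.

Local Open Scope classical_set_scope.
Local Open Scope group_scope.

(** Write [Q] for the quotient of [beta G] by [Psi].  As [beta G] is compact
    Hausdorff and [Psi] is closed, [Q] is compact Hausdorff; it inherits from
    [beta G] an associative multiplication with continuous right shifts and the
    unit [1].  What has to be explained is why [Q] is a topological group.

    The key observation ([schur_beta_invM]) is that for every ultrafilter [u]
    on [G], with image [u^-1] under inversion, the product [u^-1 * u] is a Schur
    ultrafilter: along [u] one finds [x], [y], [z] such that [x^-1 * y],
    [y^-1 * z] and their product [x^-1 * z] lie in a prescribed member.  Hence
    [Psi] identifies [u^-1 * u] with [1], so every class has a left inverse, [Q]
    is a group, and its inversion is induced by the continuous map [u |-> u^-1],
    hence continuous.  Left shifts are conjugate to right shifts by inversion,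
    so the multiplication of [Q] is separately continuous.

    In a compact Hausdorff group with separately continuous multiplication and
    continuous inversion, multiplication is jointly continuous
    ([compact_semitopological_group]).  If it were not, every nonempty open set
    would contain [x], [y] with [x^-1 * y] away from the unit, and a sequence
    [x_n] with all [x_m^-1 * x_n], [m < n], away from the unit could be built;
    at a cluster point [q] this contradicts [q^-1 * q = 1].

    The map [hPsi] has dense range because principal ultrafilters are dense, and
    is continuous because [Psi] kills the ultrafilters converging to [1].  A
    continuous homomorphism [f] from [G] to a compact Hausdorff group [H]
    extends to a continuous homomorphism [F] on [beta G].  The kernel of [F] is
    a closed congruence; it contains the generators of [Psi], since [f] is
    continuous at [1] and since the limit [z] of [f] along a Schur ultrafilter
    satisfies [z * z = z].  So [F] factors through [Q]. *)

Lemma continuous_composition (R S T : topologicalType) (g : S -> T)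
  (f : R -> S) : continuous g -> continuous f -> continuous (g \o f).
Proof. by move=> gC fC x; apply: continuous_comp; [exact: fC|exact: gC]. Qed.

(** * The space of ultrafilters *)

Lemma ultrafilter_of_setVsetC (T : Type) (F : set_system T) :
  ProperFilter F -> (forall A, F A \/ F (~` A)) -> UltraFilter F.
Proof.
move=> FF FVC; split=> // K KF FK; rewrite eqEsubset; split=> // A KA.
have [//|/FK KnA] := FVC A.
by have /filter_ex[x []] : K (A `&` ~` A) by exact: filterI.
Qed.

Lemma fmap_ultra (T U : Type) (f : T -> U) (F : set_system T) :
  UltraFilter F -> UltraFilter (f @ F).
Proof.
move=> FU; apply: ultrafilter_of_setVsetC => A.
exact: (in_ultra_setVsetC (f @^-1` A) FU).
Qed.

Section beta_space.
Variable S : Type.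
Implicit Types (u v : beta S) (A : set S).

Lemma open_beta_base A : open (beta_base A).
Proof. by exists [set A] => //; rewrite bigcup_set1. Qed.

Lemma nbhs_betaP u (O : set (beta S)) :
  nbhs u O <-> exists2 A, ultra_sets u A & beta_base A `<=` O.
Proof.
split=> [|[A uA AO]].
  rewrite nbhsE => -[B [[D _ <-] [A DA uA]] BO].
  by exists A => // v vA; apply: BO; exists A.
apply: filterS AO _; apply: open_nbhs_nbhs; split=> //.
exact: open_beta_base.
Qed.

Lemma beta_hausdorff : hausdorff_space (beta S).
Proof.
move=> u v uv; apply: beta_ext.
have sub w w' A : cluster (nbhs w) w' -> ultra_sets w A -> ultra_sets w' A.
  move=> ww' wA; have [//|w'nA] := in_ultra_setVsetC A (ultra_setsP w').
  have [//| | z [zA znA]] := ww' (beta_base A) (beta_base (~` A)).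
  - by apply/nbhs_betaP; exists A.
  - by apply/nbhs_betaP; exists (~` A).
  - by have /filter_ex[x []] : ultra_sets z (A `&` ~` A) by exact: filterI.
move=> A; split; first exact: sub.
by apply: sub; rewrite /cluster/= meetsC.
Qed.

(** The limit of an ultrafilter of ultrafilters consists of the sets [A] that
    belong to almost all of them. *)
Lemma beta_compact : compact [set: beta S].
Proof.
rewrite compact_ultra => F FU _.
pose limF : set_system S := [set A | F (beta_base A)].
have limFF : Filter limF.
  split.
  - by apply: filterS (@filterT _ F _) => u _; exact: filterT.
  - move=> A B FA FB.
    suff: F (beta_base A `&` beta_base B).
      by apply: filterS => u []; exact: filterI.
    exact: filterI.
  - move=> A B AB FA.
    by apply: (@filterS _ F _ _ _ _ FA) => u; exact: filterS.
have limP : ProperFilter limF.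
  apply: Build_ProperFilter_ex => A FA.
  have [u uA] := @filter_ex _ F _ _ FA; exact: filter_ex uA.
have limU : UltraFilter limF.
  apply: ultrafilter_of_setVsetC => A.
  have [|FnA] := in_ultra_setVsetC (beta_base A) FU; [by left|right].
  apply: filterS FnA => u nuA.
  by have [] := in_ultra_setVsetC A (ultra_setsP u).
exists (Beta limU); split=> // O /nbhs_betaP[A FA AO].
exact: filterS AO FA.
Qed.

Lemma nbhs_principal_ex u (O : set (beta S)) :
  nbhs u O -> exists x, O (principal x).
Proof.
move=> /nbhs_betaP[A uA AO]; have [x Ax] := filter_ex uA.
by exists x; apply: AO; apply/principal_filterP.
Qed.

Lemma beta_continuous (T : topologicalType) (f : T -> beta S) :
  (forall A, open (f @^-1` beta_base A)) -> continuous f.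
Proof.
move=> fo x O /nbhs_betaP[A fA AO].
have : nbhs x (f @^-1` beta_base A) by apply: open_nbhs_nbhs; split.
by apply: filterS => y; exact: AO.
Qed.

(** By regularity of [T], a neighbourhood of the limit at [u] contains
    [closure W] for a smaller neighbourhood [W]; all ultrafilters containing
    [f @^-1` W], and these form a neighbourhood of [u], have their limits in
    [closure W]. *)
Lemma beta_extension (T : topologicalType) (f : S -> T) :
    hausdorff_space T -> compact [set: T] ->
  exists2 F : beta S -> T, continuous F & forall u, f @ ultra_sets u --> F u.
Proof.
move=> hT cT.
have ex_lim u : exists t : T, f @ ultra_sets u --> t.
  move: cT; rewrite compact_ultra => /(_ _ (fmap_ultra f (ultra_setsP u))).
  by case=> [|t [_ ft]]; [exact: filterT|exists t].
have [F FE] := choice ex_lim; exists F => // u O Onbhs.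
have [W Wnbhs WO] := compact_regular hT cT (filterT : nbhs (F u) setT) Onbhs.
apply/nbhs_betaP; exists (f @^-1` W); first exact: (FE u W Wnbhs).
move=> v vW; apply: WO => B /(FE v) vB.
have /filter_ex[x [Wx Bx]] : ultra_sets v (f @^-1` W `&` f @^-1` B).
  exact: filterI.
by exists (f x).
Qed.

End beta_space.

Section beta_semigroup.
Variable S : semigroupType.
Implicit Types u : beta S.

Lemma beta_mulr_continuous u : continuous (fun v : beta S => v * u).
Proof. by apply: beta_continuous => A; exact: open_beta_base. Qed.

Lemma principalM : {morph @principal S : x y / x * y}.
Proof.
move=> x y; apply: beta_ext => A; rewrite /= /beta_mul_sets /=.
split=> [/principal_filterP Axy|].
  by apply/principal_filterP; apply/principal_filterP.
by move=> /principal_filterP /principal_filterP Axy; apply/principal_filterP.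
Qed.

(** Joint continuity in [T] makes the limit of the products, along [u] and then
    along [v], the product of the limits. *)
Lemma beta_extensionM (T : pretopologicalSemigroupType) (f : S -> T)
    (F : beta S -> T) :
    hausdorff_space T -> continuous (fun p : T * T => p.1 * p.2) ->
    {morph f : x y / x * y} -> (forall u, f @ ultra_sets u --> F u) ->
  {morph F : u v / u * v}.
Proof.
move=> hT mulC fM FE u v.
apply: (cvg_unique hT (FE (u * v))) => O /(mulC (F u, F v)) [[V W] /= [Vu Wv]].
move=> VWO; have uV : ultra_sets u (f @^-1` V) := FE u V Vu.
have vW : ultra_sets v (f @^-1` W) := FE v W Wv.
change (ultra_sets u [set s | ultra_sets v [set t | O (f (s * t))]]).
apply: filterS uV => s Vs; apply: filterS vW => t Wt /=.
by rewrite fM; exact: (VWO (f s, f t)).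
Qed.

End beta_semigroup.

(** * Quotients by closed congruences *)

Section closed_congruence_quotient.
Variables (S : pretopologicalSemigroupType) (rho : set (S * S)).
Hypothesis rhoC : is_congruence rho.
Local Notation Q := (congruence_quotient rhoC).
Local Notation cl := (congruence_class rhoC).

Lemma congruence_class_surj (q : Q) : exists x, q = cl x.
Proof. by exists (repr q); rewrite /congruence_class reprK. Qed.

Lemma congruence_classM : {morph cl : x y / x * y}.
Proof. by move=> x y; apply/esym; exact: quotient_mulE. Qed.

Lemma congruence_class_continuous : continuous cl.
Proof. exact: pi_continuous. Qed.

Lemma congruence_quotient_continuous (T : topologicalType) (f : Q -> T) :
  continuous (f \o cl) -> continuous f.
Proof. by move=> fc; apply/quotient_continuous. Qed.

Lemma congruence_quotient_compact :
  compact [set: S] -> compact [set: Q].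
Proof.
move=> cS; have -> : [set: Q] = cl @` setT.
  rewrite eqEsubset; split=> // q _.
  by have [x ->] := congruence_class_surj q; exists x.
by apply: continuous_compact => //; apply: continuous_subspaceT;
  exact: congruence_class_continuous.
Qed.

Hypotheses (rho_closed : closed rho) (S_compact : compact [set: S]).

(** The complement of this set is the projection, along a compact factor, of a
    closed set: the pairs in [rho] whose second component is outside [O]. *)
Lemma open_saturated_core (O : set S) :
  open O -> open [set z | forall y, rho (z, y) -> O y].
Proof.
move=> Oo; rewrite openE => z zO.
have /compact_near_coveringP cov := S_compact.
suff: \forall z' \near z, [set: S] `<=` (fun y => rho (z', y) -> O y).
  by apply: filterS => z' zO' y; exact: zO'.
apply: (cov S (nbhs z) (fun z' y => rho (z', y) -> O y)) => x _.
have [Ox|nOx] := pselect (O x).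
  exists (O, setT) => [|[y w] [/= Oy _] _ //].
  by split; [exact: open_nbhs_nbhs|exact: filterT].
have : nbhs (z, x) (~` rho).
  by apply: open_nbhs_nbhs; split; [exact: closed_openC|move=> /zO].
move=> [[A B] /= [Az Bx] AB]; exists (B, A) => // -[y w] /= [By Aw] wy.
by case: (AB (w, y)).
Qed.

Lemma congruence_class_repr (x : S) : rho (repr (cl x), x).
Proof.
by apply/(congruence_classP rhoC); rewrite {1}/congruence_class reprK.
Qed.

Let image_core (O : set S) : set Q :=
  [set q | forall y, rho (repr q, y) -> O y].

Let open_image_core (O : set S) : open O -> open (image_core O).
Proof.
move=> /open_saturated_core; suff -> :
  [set z | forall y, rho (z, y) -> O y] = cl @^-1` image_core O by [].
rewrite eqEsubset; split=> z zO y zy; apply: zO.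
  exact: congruence_trans (congruence_sym rhoC (congruence_class_repr z)) zy.
exact: congruence_trans (congruence_class_repr z) zy.
Qed.

Lemma closed_congruence_class (x : S) : closed [set y | rho (x, y)].
Proof.
apply: (closed_comp (f := fun y => (x, y))) => // y _.
by apply: cvg_pair => //=; exact: cvg_cst.
Qed.

(** Two distinct classes are disjoint closed sets, which normality separates by
    open sets; the classes contained in the latter form disjoint open sets of
    the quotient. *)
Lemma closed_congruence_quotient_hausdorff :
  hausdorff_space S -> hausdorff_space Q.
Proof.
move=> hS; rewrite open_hausdorff => a b ab.
have nab : ~ rho (repr a, repr b).
  by move/(congruence_classP rhoC); rewrite /congruence_class !reprK; exact/eqP.
pose K c : set S := [set y | rho (c, y)].
have Kb : set_nbhs (K (repr a)) (~` K (repr b)).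
  move=> y ay; apply: open_nbhs_nbhs; split.
    by apply: closed_openC; exact: closed_congruence_class.
  move=> /(congruence_sym rhoC); apply: contra_not nab => yb.
  exact: congruence_trans ay yb.
have [V KV VK] := compact_normal hS S_compact (@closed_congruence_class _) Kb.
exists (image_core V^°, image_core (~` closure V)) => /=.
  split; rewrite inE => y /= cy; first exact: KV.
  by move=> /VK.
split.
- by apply: open_image_core; exact: open_interior.
- by apply: open_image_core; apply: closed_openC; exact: closed_closure.
- apply/eqP; rewrite -subset0 => q [/(_ _ (congruence_refl rhoC _)) qV].
  move=> /(_ _ (congruence_refl rhoC _)) []; apply: subset_closure.
  exact: interior_subset qV.
Qed.

End closed_congruence_quotient.

(** * Compact groups with separately continuous multiplication *)

Lemma cluster_closed_image (S T : topologicalType) (f : S -> T) (x : nat -> S)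
    (q : S) (D : set T) (m : nat) :
    cluster (x @ \oo) q -> continuous f -> closed D ->
  (forall n, (m < n)%N -> D (f (x n))) -> D (f q).
Proof.
move=> xq fC Dc Dx.
have : closed (f @^-1` D) by apply: closed_comp => // z _; exact: fC.
rewrite closure_id => Dcl; suff: (f @^-1` D) q by [].
rewrite Dcl; move: xq; rewrite clusterE; apply.
by exists m.+1.
Qed.

Section compact_semitopological_group.
Variables (S : pretopologicalSemigroupType) (e : S) (inv : S -> S).
Hypotheses (hS : hausdorff_space S) (cS : compact [set: S]).
Hypotheses (mul1g : forall x : S, e * x = x) (mulg1 : forall x : S, x * e = x).
Hypotheses (mulVg : forall x : S, inv x * x = e).
Hypotheses (mulgV : forall x : S, x * inv x = e).
Hypothesis inv_continuous : continuous inv.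
Hypothesis mulr_continuous : forall y : S, continuous (fun x : S => x * y).

Let mulIg (z x y : S) : x * z = y * z -> x = y.
Proof.
by move=> /(congr1 (fun t => t * inv z)); rewrite -!mulgA mulgV !mulg1.
Qed.

Let invK : involutive inv.
Proof. by move=> x; apply: (@mulIg (inv x)); rewrite mulVg mulgV. Qed.

Let invM (x y : S) : inv (x * y) = inv y * inv x.
Proof.
apply: (@mulIg (x * y)); rewrite mulVg -mulgA (mulgA (inv x)) mulVg.
by rewrite mul1g mulVg.
Qed.

Lemma mull_continuous (x : S) : continuous (fun y : S => x * y).
Proof.
have -> : (fun y : S => x * y) = inv \o ((fun y => y * inv x) \o inv).
  by apply/funext => y /=; rewrite invM !invK.
apply: (continuous_composition inv_continuous).
exact: (continuous_composition (@mulr_continuous (inv x)) inv_continuous).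
Qed.

(** Let [closure V `<=` U] with [V] a neighbourhood of [e], and let [W] be the
    complement of [closure V].  If no such [O] exists, then every nonempty open
    set [O] contains a point [x] and a nonempty open [O' `<=` O] such that
    [inv x * y] is in [W] for all [y] in [O'].  Iterating gives a sequence with
    [inv (x m) * x n] in [W] whenever [m < n].  For a cluster point [q], letting
    [n] and afterwards [m] tend to [q] puts [e = inv q * q] in [closure W],
    although [V] is disjoint from [W]. *)
Lemma small_open_set (U : set S) : nbhs e U ->
  exists O, [/\ open O, O !=set0 & forall x y, O x -> O y -> U (inv x * y)].
Proof.
move=> eU; have [V eV VU] := compact_regular hS cS (filterT : nbhs e setT) eU.
apply: contrapT => noO; pose W := ~` closure V.
have Wo : open W by apply: closed_openC; exact: closed_closure.
pose openS := {O : set S | open O /\ O !=set0}.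
have step (O : openS) : exists p : S * openS,
    [/\ sval O p.1, sval p.2 `<=` sval O &
        forall y, sval p.2 y -> W (inv p.1 * y)].
  case: O => O [Oo O0]; apply: contrapT => noxy; apply: noO.
  exists O; split=> // x y Ox Oy; apply: contrapT => nUxy; apply: noxy.
  pose O' := O `&` (fun z => inv x * z) @^-1` W.
  have O'o : open O'.
    apply: openI => //.
    by have /continuousP := @mull_continuous (inv x); exact.
  have O'0 : O' !=set0 by exists y; split=> // /VU.
  by exists (x, exist _ O' (conj O'o O'0)); split=> //= z [].
have [next nextP] := choice step.
have S0 : open [set: S] /\ [set: S] !=set0 by split; [exact: openT|exists e].
pose O_ n := iter n (fun O => (next O).2) (exist _ [set: S] S0 : openS).
pose x_ n := (next (O_ n)).1.
have O_le m n : sval (O_ (n + m)%N) `<=` sval (O_ m).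
  elim: n => [//|n IHn]; rewrite addSn; apply: subset_trans IHn.
  by have [] := nextP (O_ (n + m)%N).
have x_W m n : (m < n)%N -> W (inv (x_ m) * x_ n).
  move=> mn; have [_ _] := nextP (O_ m); apply.
  apply: (O_le m.+1 (n - m.+1)%N); rewrite subnK //.
  by have [] := nextP (O_ n).
have xF : ProperFilter (x_ @ \oo) by exact: fmap_proper_filter.
have [q [_ xq]] := cS xF filterT.
have Wq m : closure W (inv (x_ m) * q).
  apply: (cluster_closed_image (f := fun y => inv (x_ m) * y) (m := m) xq).
  - exact: mull_continuous.
  - exact: closed_closure.
  - by move=> n mn; apply: subset_closure; exact: x_W.
have /(_ V eV) [z [Wz Vz]] : closure W e.
  rewrite -(mulVg q).
  apply: (cluster_closed_image (f := fun y => inv y * q) (m := 0) xq) => //.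
  - exact: (continuous_composition (@mulr_continuous q) inv_continuous).
  - exact: closed_closure.
by apply: Wz; exact: subset_closure.
Qed.

(** Translating the set of the previous lemma by one of its points gives a
    neighbourhood [V] of [e] with [inv V * V `<=` U]; separate continuity then
    carries joint continuity from [(e, e)] to all points. *)
Lemma mul_continuous : continuous (fun p : S * S => p.1 * p.2).
Proof.
move=> [a b] O abO.
have eO : nbhs e ((fun t => (a * t) * b) @^-1` O).
  have := continuous_composition (@mulr_continuous b) (@mull_continuous a).
  by apply; rewrite /= mulg1.
have [N [No [v Nv] NO]] := small_open_set eO.
have vN : nbhs v N by exact: open_nbhs_nbhs.
have aN : nbhs a ((fun x => v * (inv x * a)) @^-1` N).
  have := continuous_composition (@mulr_continuous a) inv_continuous.
  move=> /(continuous_composition (@mull_continuous v)).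
  by apply; rewrite /= mulVg mulg1.
have bN : nbhs b ((fun y => v * (y * inv b)) @^-1` N).
  have := @mulr_continuous (inv b).
  move=> /(continuous_composition (@mull_continuous v)).
  by apply; rewrite /= mulgV mulg1.
exists ((fun x => v * (inv x * a)) @^-1` N, (fun y => v * (y * inv b)) @^-1` N).
  by split; [exact: aN|exact: bN].
move=> [x y] /= [xN yN]; have := NO _ _ xN yN.
congr O; rewrite !invM invK -!mulgA mulVg mulg1 (mulgA (inv v)) mulVg mul1g.
by rewrite mulgA mulgV mul1g.
Qed.

Lemma compact_semitopological_group : is_topological_group S.
Proof. by split; [exact: mul_continuous|exists e, inv; split]. Qed.

End compact_semitopological_group.

(** * Schur ultrafilters and inversion *)

Section beta_group.
Variable G : groupType.
Implicit Types u : beta G.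

Lemma principal1_mul u : principal 1 * u = u.
Proof.
apply: beta_ext => A.
rewrite /= /beta_mul_sets /=.
have E : [set t | A (1 * t)] = A by apply/funext => t /=; rewrite mul1g.
split=> [/principal_filterP|uA]; first by rewrite /= E.
by apply/principal_filterP; rewrite /= E.
Qed.

Lemma mul_principal1 u : u * principal 1 = u.
Proof.
apply: beta_ext => A; rewrite /= /beta_mul_sets /=.
suff -> : [set s | principal_filter (1 : G) [set t | A (s * t)]] = A by [].
apply/funext => s /=; apply/propext.
split=> [/principal_filterP|sA]; first by rewrite /= mulg1.
by apply/principal_filterP; rewrite /= mulg1.
Qed.

Definition beta_inv u : beta G :=
  Beta (fmap_ultra (fun x : G => x^-1) (ultra_setsP u)).

Lemma beta_inv_continuous : continuous beta_inv.
Proof. by apply: beta_continuous => A; exact: open_beta_base. Qed.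

(** If [U] belongs to this product, then one can pick [x], [y], [z]
    successively, each in a suitable member of [u], so that [x^-1 * y],
    [y^-1 * z] and their product [x^-1 * z] all lie in [U]. *)
Lemma schur_beta_invM u : is_schur (beta_inv u * u).
Proof.
move=> U uU.
pose D := [set x | ultra_sets u [set y | U (x^-1 * y)]].
have uD : ultra_sets u D by [].
have [x Dx] := filter_ex uD.
have [y [Dy Uxy]] := @filter_ex _ (ultra_sets u) _ _ (filterI uD Dx).
have [z [Uxz Uyz]] := @filter_ex _ (ultra_sets u) _ _ (filterI Dx Dy).
by exists (x^-1 * y), (y^-1 * z); split=> //; rewrite -mulgA mulVKg.
Qed.

End beta_group.

(** * The quotient by the congruence [Psi] *)

Section quotient_by_Psi.
Variable G : topologicalGroupType.
Local Notation Q := (beta_mod_Psi G).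
Local Notation cl := (congruence_class (Psi_congruence G)).
Local Notation e := (cl (principal (1 : G))).

Lemma beta_mod_Psi_compact : compact [set: Q].
Proof. by apply: congruence_quotient_compact; exact: beta_compact. Qed.

Lemma beta_mod_Psi_hausdorff : hausdorff_space Q.
Proof.
apply: closed_congruence_quotient_hausdorff.
- exact: (least_closed_congruence_closed _).2.
- exact: beta_compact.
- exact: beta_hausdorff.
Qed.

(** If this failed, some ultrafilter converging to [1] would contain the
    complement of the preimage.  But its class is [e], so [U] contains the
    classes of all ultrafilters that contain a suitable member [A] of it, and
    [hPsi] maps [A] into [U]. *)
Lemma hPsi_continuous_at1 (U : set Q) :
  nbhs e U -> nbhs (1 : G) (@hPsi G @^-1` U).
Proof.
move=> eU; apply: contrapT => nU.
have [F [FU F1]] : exists F : set_system G, UltraFilter F /\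
    within (~` (@hPsi G @^-1` U)) (nbhs (1 : G)) `<=` F.
  apply: ultraFilterLemma; apply: Build_ProperFilter_ex => A A1.
  apply: contrapT => A0; apply: nU.
  apply: (@filterS _ (nbhs (1 : G)) _ _ _ _ A1) => x xA.
  by apply: contrapT => nUx; apply: A0; exists x; exact: xA.
pose u := Beta FU.
have ue : cl u = e.
  apply/congruence_classP; apply: sub_least_closed_congruence; right.
  exists u => // A A1; apply: F1; exact: cvg_within A1.
have : nbhs u (cl @^-1` U).
  by apply: (@congruence_class_continuous _ _ (Psi_congruence G) u); rewrite ue.
move=> /nbhs_betaP[A FA AU].
have FnU : F (~` (@hPsi G @^-1` U)) by apply: F1; exact: withinT.
have [x [Ax nUx]] := @filter_ex _ F _ _ (filterI FA FnU).
by apply: nUx; apply: AU; apply/principal_filterP.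
Qed.

Lemma hPsiM : {morph @hPsi G : x y / x * y}.
Proof. by move=> x y; rewrite /hPsi principalM congruence_classM. Qed.

Let mul1q (q : Q) : e * q = q.
Proof.
have [u ->] := congruence_class_surj q.
by rewrite -congruence_classM principal1_mul.
Qed.

Let mulq1 (q : Q) : q * e = q.
Proof.
have [u ->] := congruence_class_surj q.
by rewrite -congruence_classM mul_principal1.
Qed.

Let mulVcl (u : beta G) : cl (beta_inv u) * cl u = e.
Proof.
rewrite -congruence_classM; apply/congruence_classP.
apply: sub_least_closed_congruence; left.
by exists (beta_inv u * u) => //; exact: schur_beta_invM.
Qed.

(** In a monoid in which every element has a left inverse, left inverses are
    two-sided. *)
Let mulclV (u : beta G) : cl u * cl (beta_inv u) = e.
Proof.
rewrite -[LHS]mul1q -{1}(mulVcl (beta_inv u)) -mulgA (mulgA (cl (beta_inv u))).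
by rewrite mulVcl mul1q mulVcl.
Qed.

Let invq (q : Q) : Q := cl (beta_inv (repr q)).

Let mulVq (q : Q) : invq q * q = e.
Proof. by rewrite -{2}[q]reprK mulVcl. Qed.

Let mulqV (q : Q) : q * invq q = e.
Proof. by rewrite -{1}[q]reprK mulclV. Qed.

Let invq_cl (u : beta G) : invq (cl u) = cl (beta_inv u).
Proof. by rewrite -[LHS]mulq1 -(mulclV u) mulgA mulVq mul1q. Qed.

Let invq_continuous : continuous invq.
Proof.
apply: congruence_quotient_continuous.
have -> : invq \o cl = cl \o @beta_inv G by apply/funext => u; exact: invq_cl.
apply: continuous_composition (@beta_inv_continuous G).
exact: congruence_class_continuous.
Qed.

Let mulrq_continuous (q : Q) : continuous (fun p : Q => p * q).
Proof.
have [u ->] := congruence_class_surj q.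
apply: congruence_quotient_continuous.
have -> : (fun p : Q => p * cl u) \o cl = cl \o (fun v => v * u).
  by apply/funext => v /=; rewrite congruence_classM.
apply: continuous_composition (@beta_mulr_continuous _ u).
exact: congruence_class_continuous.
Qed.

Lemma beta_mod_Psi_topological_group : is_topological_group Q.
Proof.
apply: (@compact_semitopological_group Q e invq) => //.
- exact: beta_mod_Psi_hausdorff.
- exact: beta_mod_Psi_compact.
Qed.

(** Translation by [hPsi x] reduces continuity at [x] to continuity at [1]. *)
Lemma hPsi_continuous : continuous (@hPsi G).
Proof.
move=> x U xU.
have eU : nbhs e ((fun q : Q => q * hPsi x) @^-1` U).
  by apply: (mulrq_continuous (q := hPsi x)); rewrite mul1q.
have xC : continuous (fun y : G => y * x^-1).
  move=> y; apply: (@continuous_comp _ _ _ (fun y : G => (y, x^-1))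
    (fun p : G * G => p.1 * p.2)); last exact: mulg_continuous.
  by apply: cvg_pair => //=; exact: cvg_cst.
have : nbhs x ((fun y : G => y * x^-1) @^-1`
    (@hPsi G @^-1` ((fun q : Q => q * hPsi x) @^-1` U))).
  by apply: xC; rewrite mulgV; exact: hPsi_continuous_at1.
by apply: filterS => y /=; rewrite -hPsiM mulgVK.
Qed.

Lemma hPsi_dense : dense (range (@hPsi G)).
Proof.
move=> O [q Oq] Oo; have [u qu] := congruence_class_surj q.
have : nbhs u (cl @^-1` O).
  apply: (@congruence_class_continuous _ _ (Psi_congruence G) u).
  by apply: open_nbhs_nbhs; rewrite -qu.
by move=> /nbhs_principal_ex[x Ox]; exists (hPsi x); split=> //; exists x.
Qed.

End quotient_by_Psi.

(** * The universal property *)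

Section universal_property.
Variables (G H : topologicalGroupType) (f : G -> H).
Hypotheses (hH : hausdorff_space H).
Hypotheses (fC : continuous f) (fM : {morph f : x y / x * y}).
Variable F : beta G -> H.
Hypotheses (FC : continuous F) (FE : forall u, f @ ultra_sets u --> F u).

Let f1 : f 1 = 1.
Proof. by apply: (@mulgI _ (f 1)); rewrite -fM !mulg1. Qed.

Lemma extension_principal (x : G) : F (principal x) = f x.
Proof.
have fx : f @ ultra_sets (principal x) --> f x.
  by move=> A /nbhs_singleton fxA; apply/principal_filterP.
exact: (cvg_unique hH (@FE (principal x)) fx).
Qed.

(** If the limit [z] of [f] along [u] were not [1], then [z * z] and [z] would
    have disjoint neighbourhoods, and the points where [f] is close to [z]
    would form a member of [u] without a triple [x], [y], [x * y]. *)
Lemma extension_schur (u : beta G) : is_schur u -> F u = 1.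
Proof.
move=> uS; apply: (@mulgI _ (F u)); rewrite mulg1.
apply: hH => A B zA zB.
have [[V W] /= [zV zW] VWA] := @mulg_continuous H (F u, F u) A zA.
have zVWB : nbhs (F u) (V `&` W `&` B) by do 2?apply: filterI.
have [x [y [[[Vx _] _] [[_ Wy] _] [_ Bxy]]]] := uS _ (@FE u _ zVWB).
by exists (f (x * y)); split=> //; rewrite fM; exact: (VWA (f x, f y)).
Qed.

Lemma extension_Ult (u : beta G) : Ult u -> F u = 1.
Proof.
move=> u1; have uf : f @ ultra_sets u --> f 1 by move=> A /fC; exact: u1.
by rewrite -f1; exact: (cvg_unique hH (@FE u) uf).
Qed.

Lemma extension_kernel_closed_congruence :
  is_closed_congruence [set p : beta G * beta G | F p.1 = F p.2].
Proof.
have FM := beta_extensionM hH (@mulg_continuous H) fM FE.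
split.
  by split=> //= [x y z -> //|a b c d ab cd]; rewrite !FM ab cd.
move=> [u v] uv; apply: hH => A B uA vB.
have [] := uv ((F @^-1` A) `*` (F @^-1` B)).
  by exists (F @^-1` A, F @^-1` B) => //; split; exact: FC.
by move=> [u' v'] /= [uv' [Au' Bv']]; exists (F u'); split=> //; rewrite uv'.
Qed.

Lemma Psi_sub_kernel (u v : beta G) : (@Psi G) (u, v) -> F u = F v.
Proof.
have gen_sub : @Psi_gen G `<=` [set p | F p.1 = F p.2].
  by move=> _ [[w wP <-]|[w wP <-]] /=; rewrite extension_principal f1;
    [exact: extension_schur|exact: extension_Ult].
move=> uv.
exact: (least_closed_congruence_min extension_kernel_closed_congruence
          gen_sub uv).
Qed.

End universal_property.

Theorem theorem2p6 (G : topologicalGroupType) (hG : hausdorff_space G) :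
  @is_bohr_compactification G (beta_mod_Psi G) (@hPsi G).
Proof.
split.
- split; [exact: beta_mod_Psi_topological_group|exact: beta_mod_Psi_hausdorff|].
  exact: beta_mod_Psi_compact.
- exact: hPsi_continuous.
- exact: hPsiM.
- exact: hPsi_dense.
move=> H f hH cH fC fM; have [F FC FE] := beta_extension f hH cH.
have Frepr (u : beta G) :
    F (repr (congruence_class (Psi_congruence G) u)) = F u.
  by apply: (Psi_sub_kernel hH fC fM FC FE); exact: congruence_class_repr.
exists (F \o repr); split.
- apply: congruence_quotient_continuous.
  have -> // : (F \o repr) \o congruence_class (Psi_congruence G) = F.
  by apply/funext => u; exact: Frepr.
- move=> p q; have [u ->] := congruence_class_surj p.
  have [v ->] := congruence_class_surj q.
  rewrite -congruence_classM /= !Frepr.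
  exact: (beta_extensionM hH (@mulg_continuous H) fM FE).
- by apply/funext => x; rewrite /= Frepr (extension_principal hH FE).
Qed.
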